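(* Let $p>0$ and suppose that a class of functions $\mathfrak{F}\subset L^2(\mathbb{R}^2)$ is uniformly $L^2$-bounded (i.e. $\sup_{f\in\mathfrak{F}}\|f\|_2<\infty$) and contains a copy of $\ell^p_0$. Let $\Phi=(\varphi_n)_{n\in\mathbb{N}}$ be a given dictionary in $L^2(\mathbb{R}^2)$ and let $\pi$ be a fixed polynomial specifying the search depth. Then there is a constant $C>0$ such that for every $N_0\in\mathbb{N}$ there are a function $f\in\mathfrak{F}$ and an $N\in\mathbb{N}$, $N\ge N_0$, with $$\|f-f_N\|_2^2\ \ge\ C\,\big(N\log_2(N)\big)^{-(2-p)/p},$$ where $f_N$ denotes the best $N$-term approximation of $f$ with respect to $\Phi$ under the polynomial depth search constraint given by $\pi$.
   Context: A dictionary is a countable system $\Phi=(\varphi_n)_{n\in\mathbb{N}}\subset L^2(\mathbb{R}^2)$ whose linear span is dense in $L^2(\mathbb{R}^2)$. Polynomial depth search with polynomial $\pi$ means that the terms of an $N$-term approximation must be taken from the first $\pi(N)$ dictionary elements $\varphi_1,\dots,\varphi_{\pi(N)}$; the choice may depend on $f$. The best $N$-term approximation $f_N$ under this constraint minimizes $\|f-g\|_2$ among all $g=\sum_{n\in\Lambda_N}c_n\varphi_n$ with $\Lambda_N\subset\{1,\dots,\pi(N)\}$, $\#\Lambda_N\le N$. A class $\mathfrak{F}\subset L^2(\mathbb{R}^2)$ contains an embedded orthogonal hypercube of dimension $m$ and sidelength $\delta$ if there exist $f_0\in\mathfrak{F}$ and (pairwise) orthogonal functions $\psi_i\in L^2(\mathbb{R}^2)$,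 $i=1,\dots,m$, with $\|\psi_i\|_2=\delta$, such that all vertices $f_0+\sum_{i=1}^m\epsilon_i\psi_i$, $\epsilon_i\in\{0,1\}$, belong to $\mathfrak{F}$. $\mathfrak{F}$ contains a copy of $\ell_0^p$, $p>0$, if there is a sequence of orthogonal hypercubes $(\mathcal{H}_k)_{k\in\mathbb{N}}$ embedded in $\mathfrak{F}$, with dimensions $m_k$ and sidelengths $\delta_k$, such that $\delta_k\to0$ and, for some constant $c>0$, $m_k\ge c\,\delta_k^{-p}$ for all $k\in\mathbb{N}$. *)

(* Defs.v *)
From mathcomp Require Import all_boot all_order all_algebra.
From mathcomp Require Import finmap.
From mathcomp Require Import all_classical all_reals all_analysis.
From mathcomp Require Import complex.

Set Implicit Arguments.
Unset Strict Implicit.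
Unset Printing Implicit Defensive.

Import Order.TTheory GRing.Theory Num.Theory.
Import numFieldNormedType.Exports.

Local Open Scope classical_set_scope.
Local Open Scope ring_scope.
Local Open Scope complex_scope.

(* Elements of L^2(R^2) are represented by complex-valued functions on R * R
   that are Borel measurable and square-integrable; no quotient by
   almost-everywhere equality is taken.  A class of equivalence classes is thus
   represented by the set of all Borel representatives of its members. *)

Notation leb2 R := (@lebesgue_measure R \x @lebesgue_measure R)%E.

Definition cfun2 (R : realType) := R * R -> R[i].

Definition L2 (R : realType) : set (cfun2 R) :=
  [set f | ((fun x => complex.Re (f x)) \in Lfun (leb2 R) 2%:E) /\
           ((fun x => complex.Im (f x)) \in Lfun (leb2 R) 2%:E)].

Definition norm2 (R : realType) (f : cfun2 R) : R :=
  fine ('N[leb2 R]_2%:E[(fun x => (ComplexField.Normc.normc (f x))%:E)]).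

Definition inner2 (R : realType) (f g : cfun2 R) : R[i] :=
  (\int[leb2 R]_x complex.Re (f x * (g x)^*)) +i*
  (\int[leb2 R]_x complex.Im (f x * (g x)^*)).

Definition lincomb (R : realType) (phi : nat -> cfun2 R) (c : nat -> R[i])
    (L : {fset nat}) : cfun2 R :=
  fun x => \sum_(n <- L) c n * phi n x.

(* phi n, with n starting at 0, stands for the element usually written
   varphi_(n+1). *)
Definition dictionary (R : realType) (phi : nat -> cfun2 R) : Prop :=
  (forall n, L2 (phi n)) /\
  (forall f, L2 f -> forall e : R, 0 < e ->
     exists (L : {fset nat}) (c : nat -> R[i]),
       norm2 (fun x => f x - lincomb phi c L x) < e).

(* Because of the index shift, n.+1 <= pi(N) says that phi n is one of the
   first pi(N) elements; pi may have arbitrary real coefficients. *)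
Definition Nterm (R : realType) (phi : nat -> cfun2 R) (pi : {poly R})
    (N : nat) : set (cfun2 R) :=
  [set g | exists (L : {fset nat}) (c : nat -> R[i]),
     [/\ (#|` L| <= N)%N,
         (forall n, n \in L -> n.+1%:R <= pi.[N%:R]) &
         g = lincomb phi c L]].

Definition best_Nterm_approx (R : realType) (phi : nat -> cfun2 R)
    (pi : {poly R}) (N : nat) (f fN : cfun2 R) : Prop :=
  Nterm phi pi N fN /\
  forall g, Nterm phi pi N g ->
    norm2 (fun x => f x - fN x) <= norm2 (fun x => f x - g x).

Definition embedded_hypercube (R : realType) (F : set (cfun2 R)) (m : nat)
    (delta : R) : Prop :=
  exists (f0 : cfun2 R) (psi : 'I_m -> cfun2 R),
    [/\ F f0,
        (forall i, L2 (psi i) /\ norm2 (psi i) = delta),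
        (forall i j, i != j -> inner2 (psi i) (psi j) = 0) &
        (forall eps : 'I_m -> bool,
           F (fun x => f0 x + \sum_(i < m) (eps i)%:R * psi i x))].

(* Positivity of the sidelengths is needed for delta_k^(-p) to make sense:
   powR sends 0 to 0 for nonzero exponents. *)
Definition contains_copy_l0p (R : realType) (F : set (cfun2 R)) (p : R) : Prop :=
  exists (m : nat -> nat) (delta : nat -> R),
    [/\ (forall k, 0 < delta k),
        (forall k, embedded_hypercube F (m k) (delta k)),
        delta @ \oo --> (0 : R) &
        exists c : R, 0 < c /\ forall k, c * delta k `^ (- p) <= (m k)%:R].

Definition L2_bounded (R : realType) (F : set (cfun2 R)) : Prop :=
  exists M : R, forall f, F f -> norm2 f <= M.

Definition log2 (R : realType) (x : R) : R := ln x / ln 2.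

(* Main.v *)
(* Given a hypercube of dimension m and sidelength delta, record for each N-term
   candidate g the sign pattern of the numbers Re <g - f0, psi_i> - delta^2 / 2.
   For a fixed choice of N dictionary elements g runs over an affine space of
   real dimension 2N, whose sign patterns shatter at most 2N coordinates, so by
   Sauer-Shelah there are at most (m + 1)^(2N) of them; polynomial depth search
   leaves at most m^O(N) choices of elements.  If N log m is a small multiple of
   m, the Hamming balls of radius m / 8 around all these patterns therefore miss
   some vertex f.  Each coordinate in which f and a pattern disagree contributes
   at least delta^2 / 4 to |f - g|^2 by Bessel's inequality, so that
   |f - g|^2 >= delta^2 m / 32 for every candidate g.  Taking N of order
   m / log m makes N log N comparable to m, and delta^2 m is at least of order
   m^(1 - 2/p) since m >= c delta^(-p). *)
Require Import Defs.
From mathcomp Require Import all_boot all_order all_algebra.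
From mathcomp Require Import zify.
Import Order.TTheory GRing.Theory Num.Theory.

Set Implicit Arguments.
Unset Strict Implicit.
Unset Printing Implicit Defensive.

(** * Shattering and Hamming balls *)

Definition shatters (T : finType) (S : {set {set T}}) (A : {set T}) :=
  [forall B : {set T}, (B \subset A) ==> [exists C in S, C :&: A == B]].

Definition symdiff (T : finType) (A B : {set T}) := (A :\: B) :|: (B :\: A).

Lemma shattersP (T : finType) (S : {set {set T}}) (A : {set T}) :
  reflect (forall B : {set T}, B \subset A -> exists2 C, C \in S & C :&: A = B) (shatters S A).
Proof.
apply: (iffP forallP) => [h B BA|h B]; last first.
  by apply/implyP => /h [C CS <-]; apply/existsP; exists C; rewrite CS eqxx.
by have /implyP/(_ BA)/existsP[C /andP[CS /eqP]] := h B; exists C.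
Qed.

(* Pajor's strengthening of the Sauer-Shelah lemma. *)
Lemma card_le_shattered (T : finType) (S : {set {set T}}) :
  #|S| <= #|[set A | shatters S A]|.
Proof.
have [k] := ubnP #|S|; elim: k S => // k IH S; rewrite ltnS => Sk.
have [S0|/set0Pn[C0 C0S]] := eqVneq S set0; first by rewrite S0 cards0.
have sh0 : shatters S set0.
  apply/shattersP => B; rewrite subset0 => /eqP ->.
  by exists C0; rewrite ?setI0.
have [S1|S1] := leqP #|S| 1.
  by apply: (leq_trans S1); rewrite card_gt0; apply/set0Pn; exists set0; rewrite inE.
(* An element separating two members of [S] makes both halves [Sx] and [Sn] nonempty, hence strictly
   smaller than [S], so that induction applies to each. *)
have [x [C [D [CS DS xC xD]]]] : exists x C D, [/\ C \in S, D \in S, x \in C & x \notin D].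
  have [A [B [AS BS AB]]] : exists A B, [/\ A \in S, B \in S & A != B].
    have /card_gt0P [B] : 0 < #|S :\ C0| by move: S1; rewrite (cardsD1 C0) C0S.
    by rewrite !inE => /andP[? ?]; exists B, C0.
  move: AB; rewrite eqEsubset negb_and => /orP[] /subsetPn[x ? ?]; exists x.
    by exists A, B.
  by exists B, A.
pose Sx := [set C in S | x \in C]; pose Sn := [set C in S | x \notin C].
have cS : #|S| = #|Sx| + #|Sn|.
  rewrite -(cardsID [set G : {set T} | x \in G] S); congr (_ + _); apply: eq_card => E;
    by rewrite !inE // andbC.
have lx : 0 < #|Sx| by rewrite card_gt0; apply/set0Pn; exists C; rewrite inE CS.
have ln : 0 < #|Sn| by rewrite card_gt0; apply/set0Pn; exists D; rewrite inE DS.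
have IHx : #|Sx| <= #|[set A | shatters Sx A]| by apply: IH; lia.
have IHn : #|Sn| <= #|[set A | shatters Sn A]| by apply: IH; lia.
rewrite cS; apply: (leq_trans (leq_add IHx IHn)).
rewrite -cardsUI.
(* A set [A] shattered by both halves yields two sets shattered by [S]: [A] and [x |: A]. *)
set U := _ :|: _; set W := _ :&: _.
have xW A : A \in W -> x \notin A.
  rewrite !inE => /andP[/shattersP shx /shattersP shn]; apply/negP => xA.
  have [E] := shx set0 (sub0set _); rewrite inE => /andP[_ xE] /setP/(_ x).
  by rewrite !inE xE xA.
have xU A : A \in U -> x \notin A.
  rewrite !inE => /orP[] /shattersP sh; apply/negP => xA.
    have [E] := sh set0 (sub0set _); rewrite inE => /andP[_ xE] /setP/(_ x).
    by rewrite !inE xE xA.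
  have [E] := sh A (subxx _); rewrite inE => /andP[_ xE] /setP/(_ x).
  by rewrite !inE (negbTE xE) xA.
have cW : #|[set x |: A | A in W]| = #|W|.
  apply: card_in_imset => A B AW BW; have xA := xW _ AW; have xB := xW _ BW.
  by move=> /(congr1 (fun X => X :\ x)); rewrite !setU1K.
rewrite -cW -cardsUI addnC (_ : _ :&: _ = set0) ?cards0 ?add0n; last first.
  apply/setP => A; rewrite !in_set0; apply/negP => /setIP[/xU xA /imsetP[B _ AE]].
  by move: xA; rewrite AE !inE eqxx.
apply/subset_leq_card/subsetP => A; rewrite in_setU inE => /orP[].
  rewrite !inE => /orP[] /shattersP sh; apply/shattersP => B /sh [E];
    by rewrite inE => /andP[? _] ?; exists E.
move=> /imsetP[B BW ->]; have xB := xW _ BW; move: BW.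
rewrite !inE => /andP[/shattersP shx /shattersP shn]; apply/shattersP => E EB.
have EB' : E :\ x \subset B by rewrite subDset.
(* Traces containing [x] are realised inside [Sx], the others inside [Sn]. *)
have [xE|xE] := boolP (x \in E).
  have [G] := shx _ EB'; rewrite inE => /andP[GS xG] GB; exists G => //.
  by rewrite setIUr GB (setIidPr _) ?sub1set // setD1K.
have [G] := shn _ EB'; rewrite inE => /andP[GS xG] GB; exists G => //.
apply/setP => y; move/setP/(_ y): GB; rewrite !inE.
by case: eqVneq => [->|_] //=; rewrite (negbTE xE) (negbTE xG).
Qed.

(** * Volumes of Hamming balls *)

(** Such a set is the range of a map from ['I_n] to [option T], where [None] pads the enumeration
    when the set has fewer than [n] elements. *)
Lemma card_small_sets (T : finType) (n : nat) :
  #|[set A : {set T} | #|A| <= n]| <= #|T|.+1 ^ n.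
Proof.
rewrite -card_option -[in leqRHS](card_ord n) -card_ffun.
pose f (s : {ffun 'I_n -> option T}) := [set x | Some x \in codom s].
apply: leq_trans (leq_imset_card f _); apply/subset_leq_card/subsetP => A.
rewrite inE => An; apply/imsetP.
exists [ffun i : 'I_n => nth None [seq Some x | x <- enum A] i] => //.
apply/setP => x; rewrite inE; apply/idP/codomP => [xA|[i]].
  have ix : index x (enum A) < #|A| by rewrite cardE index_mem mem_enum.
  exists (Ordinal (leq_trans ix An)); rewrite ffunE /= (nth_map x) -?cardE //.
  by rewrite nth_index // mem_enum.
rewrite ffunE => xi.
have [iA|iA] := ltnP i #|A|; last by rewrite nth_default // size_map -cardE in xi.
by move: xi; rewrite (nth_map x) -?cardE // => -[->]; rewrite -mem_enum mem_nth // -cardE.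
Qed.

(** Expanding [(1 + 2) ^ #|T|] over subsets gives each [A] the weight [2 ^ (#|T| - #|A|)], which is
    at least [2 ^ (#|T| - r)] on the small sets when [r <= #|T|]. *)
Lemma card_small_sets_weighted (T : finType) (r : nat) :
  #|[set A : {set T} | #|A| <= r]| * 2 ^ #|T| <= 3 ^ #|T| * 2 ^ r.
Proof.
have -> : 3 ^ #|T| = \sum_(A : {set T}) 2 ^ (#|T| - #|A|).
  rewrite -[LHS]prod_nat_const (eq_bigr (fun=> 1 + 2)) // bigA_distr.
  apply: eq_bigr => A _; rewrite (bigID (mem A)) /= big1 ?mul1n => [|i ->] //.
  rewrite (eq_bigr (fun=> 2)) => [|i /negbTE ->] //.
  by rewrite prod_nat_const -(cardC (mem A)) addKn.
rewrite -sum1_card big_distrl /= big_distrl /=.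
rewrite [leqRHS](bigID (fun A : {set T} => #|A| <= r)) /=; apply: leq_trans (leq_addr _ _).
under eq_bigl do rewrite inE.
apply: leq_sum => A Ar; rewrite mul1n -expnD leq_exp2l //.
by have := max_card (mem A); lia.
Qed.

(** With v the cardinality and m = [#|T|], the weighted bound gives v^8 2^(8m) <= 3^(8m) 2^(8r) <=
    2^(13m) 2^m, hence v^8 <= 2^(6m). *)
Lemma card_small_sets_exp4 (T : finType) (r : nat) :
  8 * r <= #|T| -> #|[set A : {set T} | #|A| <= r]| ^ 4 <= 2 ^ (3 * #|T|).
Proof.
move=> rT.
have := card_small_sets_weighted T r; set v := #|_|; set m := #|T| in rT *.
move=> vm; rewrite -(leq_exp2r _ _ (isT : 0 < 2)) -!expnM.
rewrite -(leq_pmul2r (_ : 0 < 2 ^ (8 * m))) ?expn_gt0 // -expnD.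
have : (v * 2 ^ m) ^ 8 <= (3 ^ m * 2 ^ r) ^ 8 by rewrite leq_exp2r.
rewrite !expnMn -!expnM mulnC (mulnC m 8) => h; rewrite mulnC; apply: leq_trans h _.
have -> : 3 * m * 2 + 8 * m = 13 * m + m by lia.
rewrite expnD leq_mul //; last by rewrite leq_exp2l //; lia.
(* [3 ^ 8 <= 2 ^ 13] *)
by case: (posnP m) => [->|m0]; rewrite ?muln0 // !expnM leq_exp2r.
Qed.

Lemma card_ball (T : finType) (r : nat) (A : {set T}) :
  #|[set E | #|symdiff A E| <= r]| = #|[set B : {set T} | #|B| <= r]|.
Proof.
have sK : involutive (symdiff A).
  by move=> E; apply/setP => x; rewrite !inE; do 2!case: (_ \in _).
rewrite -(card_imset _ (inv_inj sK)); apply: eq_card => E; rewrite !inE.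
apply/imsetP/idP => [[G]|Er]; first by rewrite inE => ? ->.
by exists (symdiff A E); rewrite ?inE sK.
Qed.

Lemma card_bigcup_le (I T : finType) (P : pred I) (F : I -> {set T}) (k : nat) :
  (forall i, P i -> #|F i| <= k) -> #|\bigcup_(i | P i) F i| <= #|P| * k.
Proof.
move=> Fk; rewrite -sum_nat_const.
elim/big_ind2: _ => [|A a B b Aa Bb|i /Fk //]; first by rewrite cards0.
by rewrite (leq_trans (leq_card_setU _ _)) // leq_add.
Qed.

(** Union bound. Each [S i] has at most [#|T|.+1 ^ n] members by Pajor's lemma, and a ball of radius
    [r] fills at most 2^(3m/4) of the 2^m vertices, m = [#|T|]; the balls cannot cover the cube when
    there are fewer than 2^(m/4) centres, which is the hypothesis with its fourth power. *)
Lemma far_vertex (T I : finType) (n r : nat) (S : I -> {set {set T}}) :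
  (forall i A, shatters (S i) A -> #|A| <= n) ->
  8 * r <= #|T| -> (#|I| * #|T|.+1 ^ n) ^ 4 < 2 ^ #|T| ->
  exists E : {set T}, forall i A, A \in S i -> r < #|symdiff A E|.
Proof.
move=> Sn rT cI; pose V := \bigcup_i \bigcup_(A in S i) [set E | #|symdiff A E| <= r].
set v := #|[set B : {set T} | #|B| <= r]|.
have cV : #|V| <= #|I| * (#|T|.+1 ^ n * v).
  apply: card_bigcup_le => i _.
  apply: (@leq_trans (#|S i| * v)).
    by apply: card_bigcup_le => A _; rewrite card_ball.
  rewrite leq_mul2r (leq_trans (card_le_shattered _)) ?orbT //.
  apply: leq_trans (card_small_sets T n); apply/subset_leq_card/subsetP => A.
  by rewrite !inE; apply: Sn.
have [E EV] : exists E, E \notin V.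
  apply/existsP; rewrite -negb_forall; apply/negP => /forallP allV.
  have : 2 ^ #|T| <= #|V|.
    by rewrite -cardsT -card_powerset; apply/subset_leq_card/subsetP => E _; apply: allV.
  move=> /leq_trans/(_ cV); rewrite -(leq_exp2r _ _ (isT : 0 < 4)) leqNgt => /negP; apply.
  have -> : (2 ^ #|T|) ^ 4 = 2 ^ #|T| * 2 ^ (3 * #|T|) by rewrite -expnM -expnD; congr (_ ^ _); lia.
  rewrite mulnA expnMn.
  apply: (@leq_ltn_trans ((#|I| * #|T|.+1 ^ n) ^ 4 * 2 ^ (3 * #|T|))).
    by rewrite leq_mul2l card_small_sets_exp4 ?orbT.
  by rewrite ltn_pmul2r ?expn_gt0.
exists E => i A AS; rewrite ltnNge; apply: contra EV => AE.
by apply/bigcupP; exists i => //; apply/bigcupP; exists A; rewrite ?inE.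
Qed.

(** * Sign patterns of affine families *)

Local Open Scope ring_scope.

(* A linear dependence [l] between the columns of [M] indexed by [A] makes
   [\sum_i l i * ((c *m M) 0 i + a 0 i)] independent of [c], which excludes one of the
   sign patterns of [l] and [- l] on [A]. *)
Lemma sign_shatters (R : realFieldType) (n m : nat) (M : 'M[R]_(n, m))
    (a : 'rV[R]_m) (S : {set {set 'I_m}}) (A : {set 'I_m}) :
  (forall C, C \in S ->
     exists c : 'rV[R]_n, C = [set i | 0 < (c *m M) 0 i + a 0 i]) ->
  shatters S A -> (#|A| <= n)%N.
Proof.
move=> Ssign /shattersP sh; rewrite leqNgt; apply/negP => nA.
have [l [l0 lA lM]] : exists l : 'I_m -> R, [/\ exists2 i, i \in A & 0 < l i,
    forall i, i \notin A -> l i = 0 & forall c : 'rV[R]_n, \sum_i l i * (c *m M) 0 i = 0].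
  pose MA := \matrix_(i < #|A|, j < n) M j (enum_val i).
  have : kermx MA != 0.
    rewrite kermx_eq0 /row_free; apply/negP => /eqP rk.
    by have := rank_leq_col MA; rewrite rk leqNgt nA.
  move=> /rowV0Pn[v /sub_kermxP vM v0].
  have {v0} [k vk] : exists k, v 0 k != 0.
    apply/existsP; rewrite -negb_forall; apply: contra v0 => /forallP h.
    by apply/eqP/rowP => k; rewrite mxE; exact/eqP/h.
  (* A kernel vector may be negated; a positive entry is what makes [K] strictly positive below. *)
  have {k vk} [w [wM [k wk]]] : exists w : 'rV[R]_#|A|, w *m MA = 0 /\ exists k, 0 < w 0 k.
    have [vk0|vk0] := ltP 0 (v 0 k); first by exists v; split => //; exists k.
    exists (- v); rewrite mulNmx vM oppr0; split => //; exists k.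
    by rewrite mxE oppr_gt0 lt_neqAle vk.
  have kA : (0 < #|A|)%N by apply: leq_trans nA.
  have [x xA] := card_gt0P kA.
  exists (fun i => if i \in A then w 0 (enum_rank_in xA i) else 0); split.
  - by exists (enum_val k); rewrite ?enum_valP // enum_valK_in.
  - by move=> i /negbTE ->.
  move=> c; rewrite (bigID (mem A)) /= [X in _ + X]big1 ?addr0; last first.
    by move=> i /negbTE ->; rewrite mul0r.
  rewrite (reindex_onto (enum_val : 'I_#|A| -> 'I_m) (enum_rank_in xA)); last first.
    by move=> i iA; rewrite enum_rankK_in.
  under eq_bigl do rewrite enum_valP enum_valK_in eqxx.
  transitivity (\sum_j c 0 j * (w *m MA) 0 j).
    under eq_bigr do rewrite enum_valP enum_valK_in mxE mulr_sumr.
    rewrite exchange_big /=; apply: eq_bigr => j _; rewrite mxE mulr_sumr.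
    by apply: eq_bigr => i _; rewrite mxE mulrCA.
  by rewrite wM big1 // => j _; rewrite mxE mulr0.
pose K := \sum_i l i * a 0 i.
have sK (c : 'rV[R]_n) : \sum_i l i * ((c *m M) 0 i + a 0 i) = K.
  by under eq_bigr do rewrite mulrDr; rewrite big_split /= lM add0r.
have incl (P : pred 'I_m) : [set i in A | P i] \subset A.
  by apply/subsetP => i; rewrite inE => /andP[].
have pick (B : {set 'I_m}) : B \subset A -> exists c : 'rV[R]_n,
    forall i, i \in A -> (0 < (c *m M) 0 i + a 0 i) = (i \in B).
  move=> /sh[C /Ssign[c ->] <-]; exists c => i iA; by rewrite !inE iA andbT.
(* The pattern of the positive part of [l] makes every term of the sum for [K] nonnegative and one
   positive; the pattern of the negative part makes every term nonpositive. *)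
have [c cP] := pick _ (incl (fun i => 0 < l i)).
have [d dP] := pick _ (incl (fun i => l i < 0)).
have K0 : 0 < K.
  rewrite -(sK c); have [i iA li] := l0.
  rewrite (bigD1 i) //= ltr_pwDl //.
    by rewrite mulr_gt0 // cP // inE iA.
  apply: sumr_ge0 => j _; have [jA|/lA ->] := boolP (j \in A); last by rewrite mul0r.
  have := cP j jA; rewrite inE jA /=; have [lj h|lj h] := ltP 0 (l j).
    by rewrite mulr_ge0 // ltW.
  by rewrite mulr_le0 // leNgt h.
have : K <= 0.
  rewrite -(sK d); apply: sumr_le0 => j _.
  have [jA|/lA ->] := boolP (j \in A); last by rewrite mul0r.
  have := dP j jA; rewrite inE jA /=; have [lj h|lj h] := ltP (l j) 0.
    by rewrite mulr_le0_ge0 // ltW.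
  by rewrite mulr_ge0_le0 // leNgt h.
by rewrite leNgt K0.
Qed.

(** * The semi-inner product on square-integrable functions *)

(* Imported only here: the classical [set0], [setP], ... shadow those of finset. *)
From mathcomp Require Import finmap.
From mathcomp Require Import all_classical all_reals all_analysis.
From mathcomp Require Import complex.
From mathcomp Require Import ring lra.
Import numFieldNormedType.Exports.

Local Open Scope classical_set_scope.
Local Open Scope ring_scope.

(** The pointwise equation for [h] lets [ring] identify real and imaginary parts of complex
    expressions as such combinations. *)
Lemma Lfun_lin d (T : measurableType d) (R : realType) (mu : {measure set T -> \bar R})
    (p : \bar R) (a : R) (f g h : T -> R) : (1 <= p)%E ->
  f \in Lfun mu p -> g \in Lfun mu p -> (forall x, h x = a * f x + g x) -> h \in Lfun mu p.
Proof.
move=> p1 Lf Lg /funext ->; have [_ lin] := @Lfun_submod_closed _ _ _ mu _ p1.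
exact: (lin a).
Qed.

Lemma lee1_2 (R : realType) : (1 <= 2%:E :> \bar R)%E.
Proof. by rewrite lee1n. Qed.

Lemma L2_lin (R : realType) (a : R[i]) (f g : cfun2 R) :
  L2 f -> L2 g -> L2 (a *: f + g : cfun2 R).
Proof.
move=> [fr fi] [gr gi]; case: a => a b; have l12 := lee1_2 R.
split.
  apply: (Lfun_lin l12 fr (Lfun_lin l12 fi gr (fun=> erefl (- b * _ + _))) _ (a := a)).
  move=> x; rewrite !fctE; case: (f x) (g x) => u v [w z] /=.
  by rewrite /GRing.scale /=; ring.
apply: (Lfun_lin l12 fi (Lfun_lin l12 fr gi (fun=> erefl (b * _ + _))) _ (a := a)).
move=> x; rewrite !fctE; case: (f x) (g x) => u v [w z] /=.
by rewrite /GRing.scale /=; ring.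
Qed.

Lemma L2_0 (R : realType) : L2 (0 : cfun2 R).
Proof.
by split; have [h _] := Lfun_submod_closed (leb2 R) (lee1_2 R); exact: h.
Qed.

Lemma integrable_inner2 (R : realType) (f g : cfun2 R) : L2 f -> L2 g ->
  (leb2 R).-integrable setT (EFin \o (fun x => complex.Re (f x * (g x)^*)%C)) /\
  (leb2 R).-integrable setT (EFin \o (fun x => complex.Im (f x * (g x)^*)%C)).
Proof.
move=> [fr fi] [gr gi]; have l11 := lexx (1%E : \bar R).
split; apply/Lfun1_integrable.
  apply: (Lfun_lin l11 (Lfun2_mul_Lfun1 fr gr) (Lfun2_mul_Lfun1 fi gi) _ (a := 1)).
  by move=> x /=; case: (f x) (g x) => u v [w z] /=; ring.
apply: (Lfun_lin l11 (Lfun2_mul_Lfun1 fr gi) (Lfun2_mul_Lfun1 fi gr) _ (a := -1)).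
by move=> x /=; case: (f x) (g x) => u v [w z] /=; ring.
Qed.

(** Three terms are what the real or imaginary part of ((a + ib)u + v) times a conjugate splits
    into. *)
Lemma Rintegral_lin3 d (T : measurableType d) (R : realType)
    (mu : {measure set T -> \bar R}) (a b : R) (u v w h : T -> R) :
  mu.-integrable setT (EFin \o u) -> mu.-integrable setT (EFin \o v) ->
  mu.-integrable setT (EFin \o w) -> (forall x, h x = a * u x + (b * v x + w x)) ->
  \int[mu]_x h x = a * (\int[mu]_x u x) + (b * (\int[mu]_x v x) + \int[mu]_x w x).
Proof.
move=> iu iv iw /funext ->; have l11 := lexx (1%E : \bar R).
have Z c f : mu.-integrable setT (EFin \o f) ->
    mu.-integrable setT (EFin \o (fun x => c * f x)).
  move=> /Lfun1_integrable Lf; apply/Lfun1_integrable.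
  apply: (Lfun_lin l11 Lf Lf _ (a := c - 1)) => x /=; by rewrite mulrBl mul1r subrK.
have ivw : mu.-integrable setT (EFin \o (fun x => b * v x + w x)).
  apply/Lfun1_integrable/(Lfun_lin l11 _ _ (fun=> erefl) (a := b)); exact/Lfun1_integrable.
rewrite -!RintegralZl //.
rewrite -(RintegralD measurableT (Z b v iv) iw).
exact: RintegralD measurableT (Z a u iu) ivw.
Qed.

Lemma inner2_lin (R : realType) (a : R[i]) (f g h : cfun2 R) :
  L2 f -> L2 g -> L2 h ->
  inner2 (a *: f + g : cfun2 R) h = a * inner2 f h + inner2 g h.
Proof.
move=> Lf Lg Lh; have [fhr fhi] := integrable_inner2 Lf Lh.
have [ghr ghi] := integrable_inner2 Lg Lh.
case: a => a b; apply/eqP; rewrite eq_complex; apply/andP; split; apply/eqP.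
  rewrite /inner2 /= (Rintegral_lin3 (a := a) (b := - b) fhr fhi ghr); first by ring.
  suff E (u v w : R[i]) : complex.Re (((a +i* b) * u + v) * w^*)%C =
      a * complex.Re (u * w^*)%C + (- b * complex.Im (u * w^*)%C + complex.Re (v * w^*)%C).
    by move=> x; exact: E.
  by case: u v w => [f1 f2] [g1 g2] [h1 h2] /=; ring.
rewrite /inner2 /= (Rintegral_lin3 (a := a) (b := b) fhi fhr ghi); first by ring.
suff E (u v w : R[i]) : complex.Im (((a +i* b) * u + v) * w^*)%C =
    a * complex.Im (u * w^*)%C + (b * complex.Re (u * w^*)%C + complex.Im (v * w^*)%C).
  by move=> x; exact: E.
by case: u v w => [f1 f2] [g1 g2] [h1 h2] /=; ring.
Qed.

Lemma inner2C (R : realType) (f g : cfun2 R) : L2 f -> L2 g ->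
  inner2 g f = (inner2 f g)^*%C.
Proof.
move=> Lf Lg; have [fgr fgi] := integrable_inner2 Lf Lg.
rewrite /inner2 /=; congr (_ +i* _)%C.
  by apply: eq_Rintegral => x _; case: (f x) (g x) => [f1 f2] [g1 g2] /=; ring.
rewrite -mulN1r -RintegralZl //.
by apply: eq_Rintegral => x _; case: (f x) (g x) => [f1 f2] [g1 g2] /=; ring.
Qed.

Lemma norm2_ge0 (R : realType) (f : cfun2 R) : 0 <= norm2 f.
Proof. exact/fine_ge0/Lnorm_ge0. Qed.

Lemma inner2_norm2 (R : realType) (f : cfun2 R) : L2 f ->
  inner2 f f = ((norm2 f ^+ 2)%:C)%C.
Proof.
move=> Lf; have [ffr ffi] := integrable_inner2 Lf Lf.
rewrite /inner2; congr (_ +i* _)%C; last first.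
  rewrite (_ : 0 = \int[leb2 R]_x 0); last by rewrite /Rintegral integral0.
  by apply: eq_Rintegral => x _; case: (f x) => f1 f2 /=; ring.
have sq x : complex.Re (f x * (f x)^*)%C = ComplexField.Normc.normc (f x) ^+ 2.
  by case: (f x) => f1 f2 /=; rewrite sqr_sqrtr ?addr_ge0 ?sqr_ge0 //; ring.
rewrite /norm2 unlock.
have -> : (\int[leb2 R]_x (`|(ComplexField.Normc.normc (f x))%:E| `^ 2))%E =
    (\int[leb2 R]_x complex.Re (f x * (f x)^*)%C)%:E.
  rewrite /Rintegral fineK; last exact: integrable_fin_num.
  apply: eq_integral => x _; rewrite sq abse_EFin poweR_EFin powR_mulrn //.
  by rewrite real_normK // num_real.
rewrite poweR_EFin /= -powR_mulrn ?powR_ge0 // -powRrM mulVf // powRr1 //.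
by apply: Rintegral_ge0 => x _; rewrite sq sqr_ge0.
Qed.

Lemma L2D (R : realType) (f g : cfun2 R) : L2 f -> L2 g -> L2 (f + g).
Proof. by move=> Lf Lg; have := L2_lin 1 Lf Lg; rewrite scale1r. Qed.

Lemma L2Z (R : realType) (a : R[i]) (f : cfun2 R) : L2 f -> L2 (a *: f).
Proof. by move=> Lf; have := L2_lin a Lf (@L2_0 R); rewrite addr0. Qed.

Lemma L2B (R : realType) (f g : cfun2 R) : L2 f -> L2 g -> L2 (f - g).
Proof. by move=> Lf Lg; rewrite -scaleN1r addrC; exact: L2_lin. Qed.

Lemma L2_sum (R : realType) (I : Type) (s : seq I) (c : I -> R[i]) (e : I -> cfun2 R) :
  (forall i, L2 (e i)) -> L2 (\sum_(i <- s) c i *: e i).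
Proof.
move=> Le; elim: s => [|i s IH]; first by rewrite big_nil; exact: L2_0.
by rewrite big_cons; exact: L2_lin.
Qed.

Lemma inner2Dl (R : realType) (f g h : cfun2 R) : L2 f -> L2 g -> L2 h ->
  inner2 (f + g) h = inner2 f h + inner2 g h.
Proof. by move=> Lf Lg Lh; have := inner2_lin 1 Lf Lg Lh; rewrite scale1r mul1r. Qed.

Lemma inner2_0l (R : realType) (h : cfun2 R) : L2 h -> inner2 0 h = 0.
Proof.
move=> Lh; have := inner2_lin (-1) (@L2_0 R) (@L2_0 R) Lh.
by rewrite scaler0 addr0 mulN1r addNr.
Qed.

Lemma inner2Zl (R : realType) (a : R[i]) (f h : cfun2 R) : L2 f -> L2 h ->
  inner2 (a *: f) h = a * inner2 f h.
Proof.
by move=> Lf Lh; have := inner2_lin a Lf (@L2_0 R) Lh; rewrite addr0 inner2_0l // addr0.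
Qed.

Lemma inner2Bl (R : realType) (f g h : cfun2 R) : L2 f -> L2 g -> L2 h ->
  inner2 (f - g) h = inner2 f h - inner2 g h.
Proof.
by move=> Lf Lg Lh; rewrite -scaleN1r addrC inner2_lin // mulN1r addrC.
Qed.

Lemma inner2_suml (R : realType) (I : Type) (s : seq I) (c : I -> R[i])
    (e : I -> cfun2 R) (h : cfun2 R) : (forall i, L2 (e i)) -> L2 h ->
  inner2 (\sum_(i <- s) c i *: e i) h = \sum_(i <- s) c i * inner2 (e i) h.
Proof.
move=> Le Lh; elim: s => [|i s IH]; first by rewrite !big_nil inner2_0l.
by rewrite !big_cons inner2_lin ?IH //; exact: L2_sum.
Qed.

Lemma inner2Dr (R : realType) (f g h : cfun2 R) : L2 f -> L2 g -> L2 h ->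
  inner2 h (f + g) = inner2 h f + inner2 h g.
Proof.
move=> Lf Lg Lh; rewrite (inner2C (L2D Lf Lg) Lh) inner2Dl //.
by rewrite (inner2C Lf Lh) (inner2C Lg Lh) rmorphD.
Qed.

Lemma norm2D_sqr (R : realType) (f g : cfun2 R) : L2 f -> L2 g ->
  norm2 (f + g) ^+ 2 = norm2 f ^+ 2 + norm2 g ^+ 2 + 2 * complex.Re (inner2 f g).
Proof.
move=> Lf Lg; have := inner2_norm2 (L2D Lf Lg).
rewrite inner2Dl ?inner2Dr //; try exact: L2D.
rewrite (inner2C Lf Lg) !inner2_norm2 //; case: (inner2 f g) => a b /(congr1 (@complex.Re R)) /= <-.
ring.
Qed.

Lemma norm2Z_sqr (R : realType) (a : R) (f : cfun2 R) : L2 f ->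
  norm2 (a%:C%C *: f) ^+ 2 = a ^+ 2 * norm2 f ^+ 2.
Proof.
move=> Lf; have := inner2_norm2 (L2Z (a%:C)%C Lf).
rewrite inner2Zl // ?(inner2C (L2Z _ Lf) Lf) ?inner2Zl //; try exact: L2Z.
rewrite inner2_norm2 // => /(congr1 (@complex.Re R)) /= <-; ring.
Qed.

(** Without a quotient by almost-everywhere equality, [g] need not be the zero function. Since ||tg
    + h||^2 = ||h||^2 + 2tr is affine in the real number t, a nonzero slope would allow the value
    -1, which is what the chosen [t] produces. The imaginary part follows by applying this to i
    f. *)
Lemma inner2_norm0 (R : realType) (f g : cfun2 R) : L2 f -> L2 g ->
  norm2 g = 0 -> inner2 f g = 0.
Proof.
move=> + Lg g0.
have key h : L2 h -> complex.Re (inner2 h g) = 0.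
  move=> Lh; apply: contrapT => /eqP r0; set r := complex.Re _ in r0.
  pose t : R := - (norm2 h ^+ 2 + 1) / (2 * r).
  have := sqr_ge0 (norm2 (t%:C%C *: g + h)).
  rewrite norm2D_sqr //; last exact: L2Z.
  rewrite norm2Z_sqr // g0 inner2Zl // (expr0n _ 2) mulr0 add0r.
  have -> : complex.Re ((t%:C)%C * inner2 g h) = t * r.
    by rewrite (inner2C Lh Lg) /r; case: (inner2 h g) => a b /=; ring.
  rewrite /t (_ : 2 * _ = - (norm2 h ^+ 2 + 1)); first by lra.
  by field.
move=> Lf; have := key _ Lf; have := key _ (L2Z (0 +i* 1)%C Lf); rewrite inner2Zl //.
by case: (inner2 f g) => a b /=; rewrite !mul0r sub0r mul1r => /eqP; rewrite oppr_eq0 => /eqP -> ->.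
Qed.

(** * Orthogonal projection, best approximation and Bessel's inequality *)

(** Gram-Schmidt by induction: [f'] and [p'] are the residuals of [f] and of the new element [e x]
    modulo the span of [s], and removing from [f'] its component along [p'] makes it orthogonal to
    [e x] as well. The family may be linearly dependent: if [p'] has norm zero, then [f'] is already
    orthogonal to it. *)
Lemma projection_exists (R : realType) (I : eqType) (e : I -> cfun2 R) (s : seq I) :
  uniq s -> (forall i, L2 (e i)) -> forall f, L2 f ->
  exists c : I -> R[i], forall i, i \in s -> inner2 (f - \sum_(j <- s) c j *: e j) (e i) = 0.
Proof.
move=> + Le; elim: s => [_ f Lf|x s IH /= /andP[xs us] f Lf]; first by exists (fun=> 0).
have [c1 o1] := IH us f Lf; have [c2 o2] := IH us _ (Le x).
set f' := f - _ in o1; set p' := e x - _ in o2.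
have LS c : L2 (\sum_(j <- s) c j *: e j) by exact: L2_sum.
have Lf' : L2 f' by exact: L2B.
have Lp' : L2 p' by exact: L2B.
pose al := inner2 f' p' / inner2 p' p'.
pose c n := if n == x then al else c1 n - al * c2 n.
have Lap : L2 (al *: p') by exact: L2Z.
have E : f - \sum_(j <- x :: s) c j *: e j = f' - al *: p'.
  rewrite big_cons /c eqxx.
  rewrite (_ : \sum_(j <- s) _ = \sum_(j <- s) c1 j *: e j - al *: \sum_(j <- s) c2 j *: e j).
    by rewrite /f' /p' scalerBr !opprD !opprK !addrA (addrAC f).
  rewrite scaler_sumr -sumrB; apply: eq_big_seq => j js.
  by rewrite ifN ?scalerBl ?scalerA //; apply: contraNneq xs => <-.
exists c; rewrite E => i.
have os j : j \in s -> inner2 (f' - al *: p') (e j) = 0.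
  by move=> js; rewrite inner2Bl // inner2Zl // o1 // o2 // mulr0 subr0.
rewrite inE => /predU1P[->|/os //].
have -> : e x = p' + \sum_(j <- s) c2 j *: e j by rewrite subrK.
rewrite inner2Dr //; last exact: L2B.
rewrite (inner2C (LS _) (L2B Lf' Lap)) inner2_suml //; last exact: L2B.
rewrite [X in _ + X^*%C]big1_seq => [|j /andP[_ js]]; last first.
  by rewrite (inner2C (L2B Lf' Lap) (Le j)) os // rmorph0 mulr0.
rewrite rmorph0 addr0 inner2Bl // inner2Zl //.
have [p0|p0] := eqVneq (inner2 p' p') 0; last by rewrite /al divfK // subrr.
rewrite p0 mulr0 subr0; apply: inner2_norm0 => //.
have := inner2_norm2 Lp'; rewrite p0 => /(congr1 (@complex.Re R)) /= /esym/eqP.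
by rewrite sqrf_eq0 => /eqP.
Qed.

Lemma sum_scale_apply (R : realType) (I : Type) (s : seq I) (c : I -> R[i])
    (e : I -> cfun2 R) x : (\sum_(i <- s) c i *: e i) x = \sum_(i <- s) c i * e i x.
Proof. by rewrite (big_morph (fun f : cfun2 R => f x) (id1 := 0) (op1 := +%R)). Qed.

Lemma lincombE (R : realType) (phi : nat -> cfun2 R) (c : nat -> R[i]) (L : {fset nat}) :
  lincomb phi c L = \sum_(n <- L) c n *: phi n.
Proof. by apply/funext => x; rewrite sum_scale_apply. Qed.

(** Pythagoras: the residual of the projection is orthogonal to the difference of two combinations
    over [L]. *)
Lemma best_lincomb_exists (R : realType) (phi : nat -> cfun2 R) (L : {fset nat}) (f : cfun2 R) :
  (forall n, L2 (phi n)) -> L2 f ->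
  exists c, forall d, norm2 (f - lincomb phi c L) <= norm2 (f - lincomb phi d L).
Proof.
move=> Lphi Lf; have [c oc] := projection_exists (fset_uniq L) Lphi Lf.
have LS a : L2 (\sum_(n <- L) a n *: phi n) by exact: L2_sum.
exists c => d; rewrite !lincombE -ler_sqr ?nnegrE ?norm2_ge0 //.
set u := f - \sum_(n <- L) c n *: phi n.
have Lu : L2 u by exact: L2B.
pose w := \sum_(n <- L) (c n - d n) *: phi n.
have -> : f - \sum_(n <- L) d n *: phi n = u + w.
  rewrite /u /w; under [X in _ = _ + X]eq_bigr do rewrite scalerBl.
  by rewrite sumrB addrA subrK.
have Lw : L2 w by exact: L2_sum.
rewrite (norm2D_sqr Lu Lw) (inner2C Lw Lu) inner2_suml // big1_seq => [|n /andP[_ nL]].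
  by rewrite /= mulr0 addr0 lerDl sqr_ge0.
by rewrite (inner2C Lu (Lphi n)) oc // rmorph0 mulr0.
Qed.

Lemma seq_argmin (R : realType) (T : eqType) (s : seq T) (P : pred T) (v : T -> R) :
  has P s -> exists x, [/\ x \in s, P x & forall y, y \in s -> P y -> v x <= v y].
Proof.
elim: s => //= a s IH.
have [/IH[x [xs Px xm]] _|ns] := boolP (has P s).
  have [Pa|Pa] := boolP (P a); last first.
    exists x; split; rewrite ?inE ?xs ?orbT // => y; rewrite inE => /predU1P[->|]; last exact: xm.
    by rewrite (negbTE Pa).
  have [xa|ax] := leP (v x) (v a).
    exists x; split; rewrite ?inE ?xs ?orbT // => y; rewrite inE => /predU1P[->//|]; exact: xm.
  exists a; split; rewrite ?inE ?eqxx // => y; rewrite inE => /predU1P[->//|ys Py].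
  by rewrite ltW // (lt_le_trans ax) // xm.
rewrite orbF => Pa; exists a; split; rewrite ?inE ?eqxx // => y; rewrite inE => /predU1P[->//|ys Py].
by move/hasPn/(_ _ ys): ns; rewrite Py.
Qed.

(** The depth constraint leaves finitely many index sets, all contained in {0, ..., [B] - 1}, so a
    minimum over their projections is attained. *)
Lemma best_Nterm_approx_exists (R : realType) (phi : nat -> cfun2 R) (pi : {poly R})
    (N : nat) (f : cfun2 R) :
  (forall n, L2 (phi n)) -> L2 f -> exists fN, best_Nterm_approx phi pi N f fN.
Proof.
move=> Lphi Lf.
pose adm (L : {fset nat}) :=
  (#|` L| <= N)%N && all (fun n => n.+1%:R <= pi.[N%:R]) L.
pose B := Num.bound `|pi.[N%:R]|.
have BP : `|pi.[N%:R]| < B%:R by exact: archi_boundP.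
pose s := fpowerset [fset n in iota 0 B]%fset.
have adm_s L : adm L -> L \in s.
  move=> /andP[_ /allP aL]; rewrite fpowersetE; apply/fsubsetP => n /aL nL.
  suff : n \in iota 0 B by move=> nB; apply/imfsetP; exists n.
  rewrite mem_iota leq0n add0n.
  rewrite -(ltr_nat R); apply: (@lt_le_trans _ _ n.+1%:R); first by rewrite ltr_nat.
  by rewrite (le_trans nL) // ltW // (le_lt_trans (ler_norm _)).
pose c L := projT1 (cid (best_lincomb_exists L Lphi Lf)).
have cP L d : norm2 (f - lincomb phi (c L) L) <= norm2 (f - lincomb phi d L).
  exact: (projT2 (cid (best_lincomb_exists L Lphi Lf))).
have /(seq_argmin (fun L => norm2 (f - lincomb phi (c L) L)))[L [Ls aL Lm]] : has adm s.
  have a0 : adm fset0 by rewrite /adm cardfs0.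
  by apply/hasP; exists fset0; rewrite ?adm_s.
have admP L' : reflect ((#|` L'| <= N)%N /\ forall n, n \in L' -> n.+1%:R <= pi.[N%:R]) (adm L').
  apply: (iffP andP) => -[? h]; split => //; exact/allP.
exists (lincomb phi (c L) L); split.
  by have /admP[? ?] := aL; exists L, (c L).
move=> g [L' [d [cL' hL' ->]]]; apply: le_trans (cP L' d).
by have aL' : adm L' by [apply/admP]; apply: Lm => //; exact: adm_s.
Qed.

(** Expand 0 <= ||h + w||^2, where [w] has the real coefficients - Re <h, psi_i> / delta^2; only the
    real parts of the inner products then appear. *)
Lemma bessel (R : realType) (m : nat) (psi : 'I_m -> cfun2 R) (delta : R) (h : cfun2 R) :
  0 < delta -> (forall i, L2 (psi i) /\ norm2 (psi i) = delta) ->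
  (forall i j, i != j -> inner2 (psi i) (psi j) = 0) -> L2 h ->
  \sum_i complex.Re (inner2 h (psi i)) ^+ 2 <= delta ^+ 2 * norm2 h ^+ 2.
Proof.
move=> d0 Npsi opsi Lh; have Lpsi i := (Npsi i).1.
pose r i := complex.Re (inner2 h (psi i)).
pose t i := - r i / delta ^+ 2.
pose w := \sum_i ((t i)%:C)%C *: psi i.
have Lw : L2 w by exact: L2_sum.
have Nw : norm2 w ^+ 2 = \sum_i r i ^+ 2 / delta ^+ 2.
  have -> : norm2 w ^+ 2 = complex.Re (inner2 w w) by rewrite inner2_norm2.
  rewrite {1}/w inner2_suml // raddf_sum; apply: eq_bigr => i _.
  rewrite (inner2C Lw (Lpsi i)) {1}/w inner2_suml // (bigD1 i) //= big1 => [|j ji]; last first.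
    by rewrite opsi // mulr0.
  rewrite inner2_norm2 // (Npsi i).2 /= /t; field; exact: lt0r_neq0.
have hw : complex.Re (inner2 h w) = - \sum_i r i ^+ 2 / delta ^+ 2.
  rewrite (inner2C Lw Lh) {1}/w inner2_suml // -sumrN rmorph_sum raddf_sum; apply: eq_bigr => i _.
  rewrite /t /r (inner2C (Lpsi i) Lh); case: (inner2 (psi i) h) => a b /=; ring.
have := sqr_ge0 (norm2 (h + w)); rewrite norm2D_sqr // Nw hw -mulr_suml.
rewrite -/(r _); set S := \sum_i _ => H.
have : S / delta ^+ 2 <= norm2 h ^+ 2 by lra.
by rewrite ler_pdivrMr ?exprn_gt0 // mulrC.
Qed.

(** * Counting *)

(** From l <= 2^(3 + l/8), with integer division, the left side is at most 2^(32 + l), and 32 + l <=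
    3l for l >= 16. *)
Lemma expn8_le_expn2 (l : nat) : (16 <= l)%N -> (2 ^ 8 * l ^ 8 <= 2 ^ (3 * l))%N.
Proof.
move=> l16.
have h : (l <= 2 ^ (3 + l %/ 8))%N.
  rewrite expnD -[(2 ^ 3)%N]/8%N.
  apply: (@leq_trans (8 * (l %/ 8).+1)%N); first by have := ltn_ceil l (isT : 0 < 8)%N; lia.
  by rewrite leq_mul2l ltn_expl.
apply: (@leq_trans (2 ^ 8 * (2 ^ (3 + l %/ 8)) ^ 8)%N).
  by rewrite leq_mul2l leq_exp2r ?h ?orbT.
rewrite -expnM -expnD leq_exp2l //; have := leq_divM l 8; lia.
Qed.

Lemma term_count_exists (D N0 : nat) : (0 < D)%N -> exists m0 : nat, forall m, (m0 <= m)%N ->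
  exists N l : nat, [/\ (N0 <= N)%N, (2 <= N)%N, (m < 2 ^ l)%N, (2 ^ l <= N ^ 4)%N &
    (D * l * N <= m <= 2 * N * D * l)%N].
Proof.
(* The first summand yields N0^4 <= m < 2^l <= N^4, hence [N0 <= N]; the second makes [l] exceed
   both [D] and 16. *)
move=> D0; exists (N0 ^ 4 + 2 ^ (D + 16))%N => m m0.
have m1 : (0 < m)%N by apply: leq_trans m0; apply: leq_trans (leq_addl _ _); rewrite expn_gt0.
pose k := trunc_log 2 m; pose l := k.+1; pose N := (m %/ (D * l))%N.
have km : (2 ^ k <= m)%N by exact: trunc_logP.
have ml : (m < 2 ^ l)%N by exact: trunc_log_ltn.
have Dk : (D + 16 <= k)%N.
  by apply: trunc_log_max => //; apply: leq_trans m0; exact: leq_addl.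
have mN : (m < N.+1 * (D * l))%N by rewrite ltn_ceil // muln_gt0 D0.
(* After multiplication by 2^4 l^8 the left side is at most 2^(4l) = 2^4 (2^k)^4, while 2^k <= m <
   (N + 1) D l <= (N + 1) l^2. The spare factor 2^4 later pays for replacing N + 1 by 2N. *)
have h1 : (2 ^ 4 * 2 ^ l < N.+1 ^ 4)%N.
  rewrite -(ltn_pmul2r (_ : 0 < 2 ^ 4 * (l * l) ^ 4)%N) ?muln_gt0 ?expn_gt0 //.
  apply: (@leq_ltn_trans (2 ^ l * 2 ^ (3 * l))%N).
    apply: (@leq_trans (2 ^ l * (2 ^ 8 * l ^ 8))%N); last first.
      by rewrite leq_mul2l expn8_le_expn2 ?orbT //; lia.
    rewrite expnMn -expnD; apply: eq_leq; rewrite -[(2 ^ 8)%N]/(2 ^ (4 + 4))%N expnD; ring.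
  rewrite -expnD (_ : l + 3 * l = 4 + k * 4)%N; last by rewrite /l; lia.
  rewrite expnD expnM mulnCA ltn_pmul2l ?expn_gt0 // -expnMn ltn_exp2r //.
  apply: (leq_ltn_trans km); apply: (leq_trans mN).
  by rewrite leq_mul2l leq_mul2r; apply/orP; right; apply/orP; right; rewrite /l; lia.
have N2 : (2 <= N)%N.
  rewrite -ltnS -(ltn_exp2r _ _ (isT : 0 < 4)%N); apply: leq_ltn_trans h1.
  by rewrite leq_pmulr // expn_gt0.
have lN : (2 ^ l <= N ^ 4)%N.
  rewrite -(leq_pmul2l (_ : 0 < 2 ^ 4)%N) // -expnMn; apply: (leq_trans (ltnW h1)).
  by rewrite leq_exp2r //; lia.
exists N, l; split => //.
  rewrite -(leq_exp2r _ _ (isT : 0 < 4)%N) (leq_trans _ lN) // ltnW // (leq_ltn_trans _ ml) //.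
  by apply: leq_trans m0; exact: leq_addr.
apply/andP; split; first by rewrite mulnC leq_divM.
by apply: (leq_trans (ltnW mN)); rewrite -(mulnA _ D) leq_mul2r; apply/orP; right; lia.
Qed.

Lemma horner_nat_le (R : realType) (pi : {poly R}) : exists K d : nat,
  forall N, (0 < N)%N -> pi.[N%:R] <= (K * N ^ d)%:R.
Proof.
exists (Num.bound (\sum_(i < size pi) `|pi`_i|)), (size pi) => N N0.
rewrite natrM; apply: (@le_trans _ _ ((\sum_(i < size pi) `|pi`_i|) * (N ^ size pi)%:R)).
  rewrite horner_coef mulr_suml; apply: ler_sum => i _.
  rewrite (le_trans (ler_norm _)) // normrM ler_wpM2l // natrX normrX normr_nat.
  by rewrite ler_weXn2l ?ler1n // ltnW.
by rewrite ler_wpM2r // ltW // archi_boundP // sumr_ge0.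
Qed.

Lemma log2_pow2 (R : realType) (l : nat) : log2 ((2 ^ l)%:R : R) = l%:R.
Proof.
rewrite /log2 natrX lnXn // -[ln 2 *+ l]mulr_natl mulfK // gt_eqF // ln_gt0 //.
by rewrite ltr1n.
Qed.

Lemma ler_log2 (R : realType) (a b : nat) : (0 < a)%N -> (a <= b)%N ->
  log2 (a%:R : R) <= log2 b%:R.
Proof.
move=> a0 ab; rewrite /log2 ler_pM2r ?invr_gt0 ?ln_gt0 ?ltr1n //.
by rewrite ler_ln ?posrE ?ltr0n ?ler_nat // (leq_trans a0).
Qed.

(** The hypotheses give l/4 <= log2 N <= l, so m <= 2NDl <= 8D N log2 N. *)
Lemma mul_log2_bounds (R : realType) (D N l m : nat) : (0 < D)%N -> (2 <= N)%N -> (0 < m)%N ->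
  (m < 2 ^ l)%N -> (2 ^ l <= N ^ 4)%N -> (D * l * N <= m <= 2 * N * D * l)%N ->
  m%:R / (8 * D)%:R <= (N%:R * log2 N%:R : R) <= m%:R.
Proof.
move=> D0 N2 m0 ml lN /andP[Nm mN].
have l0 : (0 < l)%N by case: l mN {Nm lN ml} => //; rewrite muln0 leqNgt m0.
have Nm' : (N <= m)%N by apply: leq_trans Nm; rewrite leq_pmull // muln_gt0 D0.
have up : log2 N%:R <= l%:R :> R.
  by rewrite -(log2_pow2 R l) ler_log2 ?(leq_trans _ N2) // ltnW // (leq_ltn_trans Nm').
have low : l%:R / 4 <= log2 N%:R :> R.
  rewrite ler_pdivrMr // -(log2_pow2 R l).
  have <- : log2 (N ^ 4)%:R = log2 N%:R * 4 :> R.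
    by rewrite /log2 natrX lnXn ?ltr0n ?(leq_trans _ N2) // -[ln _ *+ 4]mulr_natr mulrAC.
  by rewrite ler_log2 // expn_gt0.
apply/andP; split.
  rewrite ler_pdivrMr ?ltr0n ?muln_gt0 //.
  apply: (@le_trans _ _ (N%:R * (l%:R / 4) * (8 * D)%:R)).
    apply: (@le_trans _ _ (2 * N * D * l)%:R); first by rewrite ler_nat.
    rewrite !natrM; lra.
  by rewrite ler_wpM2r // ler_wpM2l.
apply: (@le_trans _ _ (N%:R * l%:R)); first by rewrite ler_wpM2l.
rewrite -natrM ler_nat; apply: leq_trans Nm; rewrite mulnC leq_mul2r; apply/orP; right.
by rewrite leq_pmull.
Qed.

(** The factors are at most m^((d+1)N) and m^(4N); the fourth power of their product is m^(4(d+5)N),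
    and m < 2^l. *)
Lemma pattern_count_lt (K d N m l : nat) :
  (0 < N)%N -> (K < m)%N -> (1 < m)%N -> (N <= m)%N -> (m < 2 ^ l)%N ->
  (4 * (d + 5) * l * N <= m)%N ->
  ((((K * N ^ d).+1 ^ N) * m.+1 ^ (N + N)) ^ 4 < 2 ^ m)%N.
Proof.
move=> N0 Km m1 Nm ml lN.
have P1 : ((K * N ^ d).+1 <= m ^ d.+1)%N.
  rewrite expnS; apply: (@leq_trans (K * m ^ d + m ^ d)%N).
    rewrite -addn1 leq_add ?expn_gt0 ?(ltnW m1) // leq_mul2l.
    by case: d {lN} => [|d]; rewrite ?expn0 ?leqnn ?orbT // leq_exp2r // Nm orbT.
  by rewrite addnC -mulSn leq_mul2r Km orbT.
have P2 : (m.+1 <= m ^ 2)%N by rewrite -[(m ^ 2)%N]/(m * m)%N; nia.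
apply: (@leq_ltn_trans (((m ^ d.+1) ^ N * (m ^ 2) ^ (N + N)) ^ 4)%N).
  by rewrite leq_exp2r // leq_mul // leq_exp2r // addn_gt0 N0.
rewrite -!expnM -expnD -expnM (_ : _ * 4 = 4 * (d + 5) * N)%N; last by ring.
apply: (@leq_trans ((2 ^ l) ^ (4 * (d + 5) * N))%N).
  by rewrite ltn_exp2r // !muln_gt0 N0 addn_gt0 orbT.
rewrite -expnM leq_exp2l //; apply: leq_trans lN; apply: eq_leq; ring.
Qed.

(** * A hypercube vertex far from all candidates *)

(** Index sets become tuples of fixed length [N], of which there are [P.+1 ^ N]. Positions beyond
    the size of [L] receive the index 0 and the coefficient 0. *)
Lemma lincomb_reindex (R : realType) (phi : nat -> cfun2 R) (c : nat -> R[i]) (L : {fset nat})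
    (N P : nat) : (#|` L| <= N)%N -> (forall n, n \in L -> (n <= P)%N) ->
  exists (s : {ffun 'I_N -> 'I_P.+1}) (b : 'I_N -> R[i]),
    lincomb phi c L = \sum_j b j *: phi (s j).
Proof.
move=> cL hL; exists [ffun j : 'I_N => inord (nth 0%N L j)].
exists (fun j : 'I_N => if (j < #|` L|)%N then c (nth 0%N L j) else 0).
rewrite lincombE (big_nth 0%N) big_mkord.
rewrite (big_ord_widen N (fun j => c (nth 0%N L j) *: phi (nth 0%N L j))) // big_mkcond /=.
apply: eq_bigr => j _; case: ifP => jL; last by rewrite scale0r.
by rewrite ffunE inordK // ltnS hL // mem_nth.
Qed.

Lemma hypercube_far_vertex (R : realType) (phi : nat -> cfun2 R) (pi : {poly R})
    (N P m r : nat) (delta : R) (f0 : cfun2 R) (psi : 'I_m -> cfun2 R) :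
  0 < delta -> (forall n, L2 (phi n)) -> L2 f0 ->
  (forall i, L2 (psi i) /\ norm2 (psi i) = delta) ->
  (forall i j, i != j -> inner2 (psi i) (psi j) = 0) ->
  (forall n, n.+1%:R <= pi.[N%:R] -> (n <= P)%N) ->
  (8 * r <= m)%N -> ((P.+1 ^ N * m.+1 ^ (N + N)) ^ 4 < 2 ^ m)%N ->
  exists eps : 'I_m -> bool, forall g, Nterm phi pi N g ->
    delta ^+ 2 * (r.+1%:R / 4) <= norm2 (f0 + \sum_i (eps i)%:R *: psi i - g) ^+ 2.
Proof.
move=> d0 Lphi Lf0 Npsi opsi hP rm cnt; have Lpsi i := (Npsi i).1.
(* Since Re(bz) = Re b Re z - Im b Im z, the numbers Re <g, psi_i> depend linearly on the 2N real
   and imaginary parts of the coefficients. The shift [a] puts the threshold delta^2 / 2 midway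
   between the contributions 0 and delta^2 of a vertex. *)
pose G (s : {ffun 'I_N -> 'I_P.+1}) : 'M[R]_(N + N, m) :=
  col_mx (\matrix_(j, i) complex.Re (inner2 (phi (s j)) (psi i)))
         (\matrix_(j, i) - complex.Im (inner2 (phi (s j)) (psi i))).
pose a : 'rV[R]_m := \row_i (- complex.Re (inner2 f0 (psi i)) - delta ^+ 2 / 2).
pose S s := [set C : {set 'I_m} |
  `[< exists c : 'rV[R]_(N + N), C = [set i | 0 < (c *m G s) 0 i + a 0 i]%SET >]]%SET.
have [|||E far] := @far_vertex 'I_m {ffun 'I_N -> 'I_P.+1} (N + N) r S.
- move=> s A; apply: (sign_shatters (M := G s) (a := a)) => C.
  by rewrite inE => /asboolP.
- by rewrite card_ord.
- by rewrite card_ffun !card_ord.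
exists (fun i => i \in E) => g [L [c [cL hL ->]]].
have [s [b ->]] := lincomb_reindex phi c cL (fun n nL => hP n (hL n nL)).
pose g' := \sum_j b j *: phi (s j); set f := f0 + _; rewrite -/g'.
pose t i := complex.Re (inner2 g' (psi i)).
have Lg' : L2 g' by apply: L2_sum => j; exact: Lphi.
have LS : L2 (\sum_i (i \in E)%:R *: psi i) by exact: L2_sum.
have Lf : L2 f by exact: L2D.
pose C := [set i | 0 < t i + a 0 i]%SET.
have CS : C \in S s.
  rewrite inE; apply/asboolP.
  exists (row_mx (\row_j complex.Re (b j)) (\row_j complex.Im (b j))).
  apply/setP => i; rewrite !inE; congr (0 < _ + _).
  rewrite /t /g' inner2_suml // raddf_sum /= /G mul_row_col !mxE -big_split.
  apply: eq_bigr => j _; rewrite !mxE.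
  by case: (b j) (inner2 _ _) => [b1 b2] [z1 z2] /=; ring.
have hE i : complex.Re (inner2 (f - g') (psi i)) =
    complex.Re (inner2 f0 (psi i)) + (i \in E)%:R * delta ^+ 2 - t i.
  rewrite inner2Bl // inner2Dl // inner2_suml // (bigD1 i) // big1 ?addr0 => [|j /andP[_ ji]]; last first.
    by rewrite opsi // mulr0.
  rewrite inner2_norm2 // (Npsi i).2 /t; move: (inner2 f0 _) (inner2 g' _) => [u1 u2] [v1 v2].
  by case: (i \in E) => /=; ring.
(* On a disagreement, the vertex and the candidate lie on opposite sides of the threshold, so the
   real part has absolute value at least delta^2 / 2. *)
have big i : i \in symdiff C E -> delta ^+ 4 / 4 <= complex.Re (inner2 (f - g') (psi i)) ^+ 2.
  rewrite hE !inE mxE; set u := complex.Re _; set d2 := delta ^+ 2.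
  have -> : delta ^+ 4 = d2 ^+ 2 by rewrite -exprM.
  have d20 : 0 < d2 by rewrite exprn_gt0.
  case: (i \in E); rewrite /= ?andbF ?andbT ?orbF => ti.
    have : d2 / 2 <= u + 1 * d2 - t i by move: ti; rewrite -leNgt; lra.
    by move=> h; nra.
  have : u + 0 * d2 - t i <= - (d2 / 2) by move: ti; lra.
  by move=> h; nra.
have := bessel d0 Npsi opsi (L2B Lf Lg').
have rD : (r < #|symdiff C E|)%N by exact: far CS.
have low : r.+1%:R * (delta ^+ 4 / 4) <= \sum_i complex.Re (inner2 (f - g') (psi i)) ^+ 2.
  rewrite (bigID (mem (symdiff C E))) /=; apply: ler_wpDr; first by apply: sumr_ge0 => i _; exact: sqr_ge0.
  apply: (@le_trans _ _ (\sum_(i in symdiff C E) delta ^+ 4 / 4)); last exact: ler_sum.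
  rewrite sumr_const -[leRHS]mulr_natl ler_wpM2r ?ler_nat //.
  by rewrite divr_ge0 // exprn_ge0 // ltW.
move=> /(le_trans low); rewrite (_ : delta ^+ 4 = delta ^+ 2 * delta ^+ 2) -?exprD //.
rewrite (_ : _ * _ = delta ^+ 2 * (delta ^+ 2 * (r.+1%:R / 4))); last by field.
by rewrite ler_pM2l // exprn_gt0.
Qed.

(** * Real powers and the rate *)

Lemma ler_powR_base (R : realType) (a x y : R) :
  0 <= a -> 0 <= x -> x <= y -> x `^ a <= y `^ a.
Proof.
by move=> a0 x0 xy; apply: ge0_ler_powR; rewrite ?nnegrE // (le_trans x0).
Qed.

Lemma sidelength_small (R : realType) (p c : R) (delta : nat -> R) (B : R) :
  0 < p -> 0 < c -> (forall k, 0 < delta k) -> delta @ \oo --> (0 : R) ->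
  exists k, B <= c * delta k `^ (- p).
Proof.
(* [A] is a positive majorant of [B], and [rho] solves c rho^(-p) = A. *)
move=> p0 c0 d0 dcv; pose A := `|B| + 1; have A0 : 0 < A by rewrite ltr_wpDl.
pose rho := (c / A) `^ p^-1.
have rho0 : 0 < rho by rewrite powR_gt0 // divr_gt0.
have /cvgrPdist_lt/(_ rho rho0)[k _ /(_ k (leqnn k))] := dcv.
rewrite /= sub0r normrN gtr0_norm // => dk; exists k.
have : delta k `^ p <= c / A.
  rewrite -[leRHS](@powRr1 _ (c / A)) ?(divr_ge0 (ltW c0) (ltW A0)) // -(mulVf (lt0r_neq0 p0)) powRrM.
  by apply: ler_powR_base; rewrite ltW.
rewrite powRN ler_pdivlMr // => h.
apply: (@le_trans _ _ A); first by rewrite (le_trans (ler_norm _)) // lerDl.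
by rewrite ler_pdivlMr ?powR_gt0 // mulrC.
Qed.

Lemma powR_div (R : realType) (e x y : R) : 0 <= x -> 0 < y ->
  (x / y) `^ e = x `^ e * y `^ (- e).
Proof.
move=> x0 /ltW y0.
by rewrite powRM ?invr_ge0 // -(powR_inv1 y0) -powRrM mulN1r.
Qed.

(** The exponent of the rate is negative for p < 2 and nonnegative for p >= 2. The two summands of
    the constant serve the cases 0 <= e, by x <= y, and e < 0, by y/M <= x. *)
Lemma powR_le_of_bounds (R : realType) (e M x y : R) : 0 < M -> 0 < y ->
  y / M <= x <= y -> x `^ e <= (1 + M `^ (- e)) * y `^ e.
Proof.
move=> M0 y0 /andP[yx xy].
have yM0 : 0 < y / M by rewrite divr_gt0.
have x0 : 0 < x by apply: lt_le_trans yx.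
rewrite mulrDl mul1r; have [e0|e0] := leP 0 e.
  apply: (@le_trans _ _ (y `^ e)); first by apply: ler_powR_base => //; rewrite ltW.
  by rewrite lerDl mulr_ge0 ?powR_ge0.
apply: (@le_trans _ _ ((y / M) `^ e)); last first.
  by rewrite powR_div ?(ltW y0) // [X in X <= _]mulrC lerDr powR_ge0.
rewrite -(opprK e) !(powRN _ (- e)) lef_pV2 ?posrE ?powR_gt0 //.
by apply: ler_powR_base => //; rewrite ?oppr_ge0 ltW.
Qed.

(** Solving the dimension bound for the sidelength gives d^2 >= (c/m)^(2/p), and -(2-p)/p = 1 -
    2/p. *)
Lemma sidelength_dimension (R : realType) (p c d : R) (m : nat) :
  0 < p -> 0 < c -> 0 < d -> (0 < m)%N -> c * d `^ (- p) <= m%:R ->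
  c `^ (2 / p) * m%:R `^ (- ((2 - p) / p)) <= d ^+ 2 * m%:R.
Proof.
move=> p0 c0 d0 m0; have m0' : 0 < m%:R :> R by rewrite ltr0n.
rewrite powRN ler_pdivrMr ?powR_gt0 // => cm.
have cd : c / m%:R <= d `^ p by rewrite ler_pdivrMr // mulrC.
have : (c / m%:R) `^ (2 / p) <= d ^+ 2.
  have -> : d ^+ 2 = (d `^ p) `^ (2 / p).
    by rewrite -powRrM mulrC divfK ?gt_eqF // powR_mulrn // ltW.
  by apply: ler_powR_base => //; rewrite divr_ge0 // ltW.
move=> h.
have -> : - ((2 - p) / p) = 1 + - (2 / p) by field; exact: lt0r_neq0.
rewrite powRD ?(gt_eqF m0') ?implybT // powRr1 ?(ltW m0') // mulrCA mulrC.
by rewrite ler_pM2r // (le_trans _ h) // powR_div // ltW.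
Qed.

(** * Assembly of the lower bound *)

Theorem theorem2p2 (R : realType) (p : R) (F : set (cfun2 R))
    (phi : nat -> cfun2 R) (pi : {poly R})
    (p_gt0 : 0 < p)
    (F_L2 : F `<=` @L2 R)
    (F_bounded : L2_bounded F)
    (F_copy : contains_copy_l0p F p)
    (phi_dict : dictionary phi) :
  exists C : R, 0 < C /\
    forall N0 : nat, exists (f fN : cfun2 R) (N : nat),
      [/\ F f, (N0 <= N)%N, best_Nterm_approx phi pi N f fN &
          C * (N%:R * log2 N%:R) `^ (- ((2 - p) / p))
            <= norm2 (fun x => f x - fN x) ^+ 2].
Proof.
have [m [delta [d0 cube dcv [c [c0 cm]]]]] := F_copy.
have [Lphi _] := phi_dict.
have [K [d piK]] := horner_nat_le pi.
pose D := (4 * (d + 5))%N; have D0 : (0 < D)%N by rewrite muln_gt0 addn_gt0 orbT.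
pose e : R := - ((2 - p) / p).
pose Q : R := 1 + ((8 * D)%:R) `^ (- e).
have Q0 : 0 < Q by rewrite ltr_pwDl // powR_ge0.
(* 32 = 8 * 4: more than m/8 coordinates disagree, each contributing delta^2 / 4. [Q] is the price
   of replacing N log2 N by m. *)
exists (c `^ (2 / p) / (32 * Q)); split.
  by rewrite divr_gt0 ?powR_gt0 // mulr_gt0.
move=> N0; have [m0 choose] := term_count_exists N0 D0.
(* The dimension must reach [m0] for the choice of [N], and exceed [K] and 1 for the pattern
   count. *)
have [k] := sidelength_small (m0 + K + 2)%:R p_gt0 c0 d0 dcv.
move=> /le_trans/(_ (cm k)); rewrite ler_nat => mk.
have mk0 : (0 < m k)%N by lia.
have [N [l [N0N N2 ml lN lNm]]] := choose (m k) ltac:(lia).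
have /andP[Dm _] := lNm.
have l0 : (0 < l)%N by case: (l) ml => //; rewrite expn0; lia.
have Nm : (N <= m k)%N by apply: leq_trans Dm; rewrite leq_pmull // muln_gt0 D0.
have [f0 [psi [Ff0 Npsi opsi Fv]]] := cube k.
have [|||eps far] := @hypercube_far_vertex R phi pi N (K * N ^ d) (m k) (m k %/ 8) (delta k) f0 psi
    (d0 k) Lphi (F_L2 _ Ff0) Npsi opsi.
- move=> n nN; have := le_trans nN (piK N ltac:(lia)).
  by rewrite ler_nat; exact: ltnW.
- by rewrite mulnC leq_divM.
- by apply: (@pattern_count_lt K d N (m k) l) => //; lia.
set f : cfun2 R := f0 + _ in far.
have Ff : F f.
  rewrite (_ : f = fun x => f0 x + \sum_(i < m k) (eps i)%:R * psi i x) //.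
  by apply/funext => x; rewrite -sum_scale_apply.
have [fN [NtN best]] := best_Nterm_approx_exists pi N Lphi (F_L2 _ Ff).
exists f, fN, N; split => //; apply: le_trans (far fN NtN).
have hx := mul_log2_bounds R D0 N2 mk0 ml lN lNm.
have mR0 : 0 < (m k)%:R :> R by rewrite ltr0n.
have := powR_le_of_bounds e (_ : 0 < (8 * D)%:R) mR0 hx.
rewrite ltr0n muln_gt0 D0 => /(_ isT); rewrite -/Q -/e; set X := _ `^ e => hX.
have := sidelength_dimension p_gt0 c0 (d0 k) mk0 (cm k); rewrite -/e => hd.
apply: (@le_trans _ _ (c `^ (2 / p) / (32 * Q) * (Q * (m k)%:R `^ e))).
  by rewrite ler_pM2l // divr_gt0 ?powR_gt0 // mulr_gt0.
rewrite (_ : _ * _ = c `^ (2 / p) * (m k)%:R `^ e / 32); last by field; exact: lt0r_neq0.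
rewrite ler_pdivrMr // (le_trans hd) // -(mulrA (delta k ^+ 2)) ler_pM2l ?exprn_gt0 //.
rewrite (_ : _ / 4 * 32 = (m k %/ 8).+1%:R * 8); last by field.
by rewrite -natrM ler_nat; have := ltn_ceil (m k) (isT : 0 < 8)%N; lia.
Qed.
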